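(* Let $\varepsilon,\nu>0$. Let $\phi_h^n,\mathbf u_h^n$ ($0\le n\le N$) and $\mu_h^n,p_h^n$ ($2\le n\le N$), with $\phi_h^n,\mu_h^n,p_h^n\in\mathsf C_h$ and $\mathbf u_h^n\in\mathsf E_h$, be any solution, for $1\le n\le N-1$, of the scheme $$D_{2\tau}\mathbf u_h^{n+1}+\mathcal B_h(\mathbf u_h^{*,n+1},\mathbf u_h^{n+1})+\nu A_h\mathbf u_h^{n+1}+D_hp_h^{n+1}+\phi_h^{*,n+1}D_h\mu_h^{n+1}=0,$$ $$d_h\mathbf u_h^{n+1}=0,$$ $$D_{2\tau}\phi_h^{n+1}+A_h\mu_h^{n+1}+d_h(\phi_h^{*,n+1}\mathbf u_h^{n+1})=0,$$ $$\mu_h^{n+1}-\varepsilon^2A_h\phi_h^{n+1}-\chi(\phi_h^{\dagger,n+1},\phi_h^{\dagger,n})+\phi_h^{*,n+1}=0.$$ For $j\ge1$ put $$\mathcal E_h^j=\mathcal G(\mathbf u_h^j,\mathbf u_h^{j-1})+\varepsilon^2\mathcal G(D_h\phi_h^j,D_h\phi_h^{j-1})+(F(\phi_h^{\dagger,j}),1)_h+\tfrac38\|\phi_h^j-\phi_h^{j-1}\|_h^2 .$$ Then for $1\le n\le N-1$ $$\mathcal E_h^{n+1}-\mathcal E_h^n+\tau\|D_h\mu_h^{n+1}\|_h^2+\nu\tau\|D_h\mathbf u_h^{n+1}\|_h^2+\tfrac14\|\delta^2\mathbf u_h^{n+1}\|_h^2+\tfrac{\varepsilon^2}{4}\|D_h\delta^2\phi_h^{n+1}\|_h^2+\tfrac34\|\delta^2\phi_h^{n+1}\|_h^2=0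 .$$ In particular, $\mathcal E_h^{n+1}\le\mathcal E_h^n$.
   Context: Grid. $\Omega=(0,L_x)\times(0,L_y)$; $N_x,N_y$ are positive integers, $h_x=L_x/N_x$, $h_y=L_y/N_y$. $\mathsf C_h$ is the space of cell-centered functions $\varphi_{i+1/2,j+1/2}$, $0\le i<N_x$, $0\le j<N_y$; $\mathsf V_h$ is the space of vertex functions $g_{i,j}$, $0\le i\le N_x$, $0\le j\le N_y$; $\mathsf E_h^x$ consists of $u_{i,j+1/2}$, $1\le i<N_x$, $0\le j<N_y$; $\mathsf E_h^y$ consists of $v_{i+1/2,j}$, $0\le i<N_x$, $1\le j<N_y$; $\mathsf E_h=\mathsf E_h^x\times\mathsf E_h^y$. Boundary and ghost values (no-slip for velocities): for $u\in\mathsf E_h^x$, $u_{0,j+1/2}=u_{N_x,j+1/2}=0$, $u_{i,-1/2}=-u_{i,1/2}$, $u_{i,N_y+1/2}=-u_{i,N_y-1/2}$; for $v\in\mathsf E_h^y$, $v_{i+1/2,0}=v_{i+1/2,N_y}=0$, $v_{-1/2,j}=-v_{1/2,j}$, $v_{N_x+1/2,j}=-v_{N_x-1/2,j}$. Cell-centered functions are extended evenly across the boundary (no-flux): $\varphi_{-1/2,\cdot}=\varphi_{1/2,\cdot}$, etc., so $D_x\varphi$, $D_y\varphi$ vanish on boundary faces. Operators. For each pair of neighbouring grid values in the $x$-direction, the average is half the sum and the difference is (right minus left)$/h_x$; similarly in $y$ with $h_y$. These are denoted $a_x,d_x$ when they map values at integer $x$-indices to half-integer $x$-indices (from $x$-faces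 to cells, or from vertices to $y$-faces), $A_x,D_x$ when they map values at half-integer $x$-indices to integer $x$-indices (from cells to $x$-faces, or from $y$-faces to vertices); $a_y,d_y,A_y,D_y$ are defined analogously in $y$. E.g. $(d_xu)_{i+1/2,j+1/2}=(u_{i+1,j+1/2}-u_{i,j+1/2})/h_x$, $(D_x\varphi)_{i,j+1/2}=(\varphi_{i+1/2,j+1/2}-\varphi_{i-1/2,j+1/2})/h_x$, $(D_yu)_{i,j}=(u_{i,j+1/2}-u_{i,j-1/2})/h_y$. For $\varphi_h\in\mathsf C_h$, $\mathbf v_h=(v_{1,h},v_{2,h})\in\mathsf E_h$: $D_h\varphi_h=(D_x\varphi_h,D_y\varphi_h)\in\mathsf E_h$; $d_h\mathbf v_h=d_xv_{1,h}+d_yv_{2,h}$; $A_h\varphi_h=-d_hD_h\varphi_h$; $A_h\mathbf v_h=(-(D_xd_x+d_yD_y)v_{1,h},-(d_xD_x+D_yd_y)v_{2,h})$; the product is $\varphi_h\mathbf v_h=((A_x\varphi_h)v_{1,h},(A_y\varphi_h)v_{2,h})$ (pointwise on faces). The convection operator $\mathcal B_h(\mathbf u_h,\mathbf v_h)\in\mathsf E_h$ has components $\tfrac12[u_{1,h}D_x(a_xv_{1,h})+A_x(d_x(u_{1,h}v_{1,h}))+a_y(A_xu_{2,h}\,D_yv_{1,h})+d_y(A_yv_{1,h}\,A_xu_{2,h})]$ and $\tfrac12[a_x(A_yu_{1,h}\,D_xv_{2,h})+d_x(A_yu_{1,h}\,A_xv_{2,h})+u_{2,h}D_y(a_yv_{2,h})+A_y(d_y(u_{2,h}v_{2,h}))]$.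 Inner products and norms. $(\cdot,\cdot)_c,(\cdot,\cdot)_x,(\cdot,\cdot)_y$ are $h_xh_y$ times the sum of products over cells, interior $x$-faces, interior $y$-faces; $(r,s)_v=h_xh_y\sum_{i,j}\omega_{i,j}r_{i,j}s_{i,j}$ over vertices, with weight $\omega=1$ at interior vertices, $\frac12$ on boundary edges, $\frac14$ at corners. For scalars $(\cdot,\cdot)_h=(\cdot,\cdot)_c$; for vectors in $\mathsf E_h$, $(\mathbf u,\mathbf v)_h=(u_1,v_1)_x+(u_2,v_2)_y$; $\|\cdot\|_h$ is the induced norm. For $\mathbf v_h\in\mathsf E_h$, $\|D_h\mathbf v_h\|_h^2=\|d_xv_{1,h}\|_c^2+\|D_yv_{1,h}\|_v^2+\|D_xv_{2,h}\|_v^2+\|d_yv_{2,h}\|_c^2$. Time. $T>0$, integer $N\ge2$, $\tau=T/N$. For a sequence $q^n$: $D_{2\tau}q^{n+1}=\frac{3q^{n+1}-4q^n+q^{n-1}}{2\tau}$, $\delta^2q^{n+1}=q^{n+1}-2q^n+q^{n-1}$, $q^{*,n+1}=2q^n-q^{n-1}$, $q^{\dagger,n}=\frac{3q^n-q^{n-1}}{2}$ (for every $n\ge1$). $\mathcal G(a,b)=\frac14(\|a\|_h^2+\|2a-b\|_h^2)$, $F(s)=\frac14(s^2-1)^2$, $\chi(a,b)=\frac14(a^2+b^2)(a+b)$, the last two applied pointwise. *)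

(* Defs.v *)
From HB Require Import structures.
From mathcomp Require Import all_boot all_order all_algebra.
From mathcomp Require Import reals.

Set Implicit Arguments.
Unset Strict Implicit.
Unset Printing Implicit Defensive.

Import Order.TTheory GRing.Theory Num.Theory.

Local Open Scope ring_scope.

Record grid (R : realType) := Grid {
  Lx : R;
  Ly : R;
  Nx : nat;
  Ny : nat;
  Lx_gt0 : 0 < Lx;
  Ly_gt0 : 0 < Ly;
  Nx_gt0 : (0 < Nx)%N;
  Ny_gt0 : (0 < Ny)%N
}.

Section Space.
Context {R : realType} (g : grid R).

Local Notation Nx := (Nx g).
Local Notation Ny := (Ny g).

Definition hx : R := Lx g / Nx%:R.
Definition hy : R := Ly g / Ny%:R.

(* Entry (i, j) is the value at
     (i + 1/2, j + 1/2) for cellf,   (i, j)       for vertf,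
     (i + 1, j + 1/2)   for xfacef,  (i + 1/2, j + 1) for yfacef;
   only interior faces carry unknowns. *)
Definition cellf := 'M[R]_(Nx, Ny).
Definition vertf := 'M[R]_(Nx.+1, Ny.+1).
Definition xfacef := 'M[R]_(Nx.-1, Ny).
Definition yfacef := 'M[R]_(Nx, Ny.-1).
Definition velf := (xfacef * yfacef)%type.

(* A field is a grid function together with its boundary and ghost values.
   A half-integer position k + 1/2 is indexed by the integer k, so that the
   ghost positions -1/2 and N + 1/2 have the indices -1 and N. *)
Definition field := int * int -> R.

Definition entry m n (A : 'M[R]_(m, n)) (i j : int) : R :=
  match i, j with
  | Posz i', Posz j' =>
      match insub i', insub j' with
      | Some a, Some b => A a b
      | _, _ => 0
      end
  | _, _ => 0
  end.

(* Even reflection of the half-integer indices -1 and n. *)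
Definition reflect_idx (n : nat) (k : int) : int :=
  if k == -1 then 0 else if k == n%:Z then n%:Z - 1 else k.

(* Sign of the odd reflection: -1 at the ghost indices. *)
Definition reflect_sgn (n : nat) (k : int) : R :=
  if (k == -1) || (k == n%:Z) then -1 else 1.

Definition extC (f : cellf) : field :=
  fun k => entry f (reflect_idx Nx k.1) (reflect_idx Ny k.2).

(* entry vanishes outside the array, which gives the value 0 at i = 0, Nx. *)
Definition extX (u : xfacef) : field :=
  fun k => reflect_sgn Ny k.2 * entry u (k.1 - 1) (reflect_idx Ny k.2).

Definition extY (v : yfacef) : field :=
  fun k => reflect_sgn Nx k.1 * entry v (reflect_idx Nx k.1) (k.2 - 1).

Definition resC (f : field) : cellf := \matrix_(i, j) f (i%:Z, j%:Z).
Definition resV (f : field) : vertf := \matrix_(i, j) f (i%:Z, j%:Z).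
Definition resX (f : field) : xfacef := \matrix_(i, j) f (i.+1%:Z, j%:Z).
Definition resY (f : field) : yfacef := \matrix_(i, j) f (i%:Z, j.+1%:Z).

(* Lower case: integer to half-integer indices, k + 1/2 lying between k and
   k + 1.  Upper case: half-integer to integer indices, k lying between
   (k - 1) + 1/2 and k + 1/2. *)
Definition ax (f : field) : field := fun k => (f (k.1 + 1, k.2) + f k) / 2.
Definition dx (f : field) : field := fun k => (f (k.1 + 1, k.2) - f k) / hx.
Definition Ax (f : field) : field := fun k => (f k + f (k.1 - 1, k.2)) / 2.
Definition Dx (f : field) : field := fun k => (f k - f (k.1 - 1, k.2)) / hx.
Definition ay (f : field) : field := fun k => (f (k.1, k.2 + 1) + f k) / 2.
Definition dy (f : field) : field := fun k => (f (k.1, k.2 + 1) - f k) / hy.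
Definition Ay (f : field) : field := fun k => (f k + f (k.1, k.2 - 1)) / 2.
Definition Dy (f : field) : field := fun k => (f k - f (k.1, k.2 - 1)) / hy.

Definition gradh (f : cellf) : velf :=
  (resX (Dx (extC f)), resY (Dy (extC f))).

Definition divh (v : velf) : cellf := resC (dx (extX v.1) \+ dy (extY v.2)).

Definition AhC (f : cellf) : cellf := - divh (gradh f).

Definition AhE (v : velf) : velf :=
  (- resX (Dx (dx (extX v.1)) \+ dy (Dy (extX v.1))),
   - resY (dx (Dx (extY v.2)) \+ Dy (dy (extY v.2)))).

Definition prodh (f : cellf) (v : velf) : velf :=
  (resX (Ax (extC f) \* extX v.1), resY (Ay (extC f) \* extY v.2)).

Definition convh (u v : velf) : velf :=
  let u1 := extX u.1 in let u2 := extY u.2 in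
  let v1 := extX v.1 in let v2 := extY v.2 in
  (2^-1 *: resX (u1 \* Dx (ax v1) \+ Ax (dx (u1 \* v1))
                 \+ ay (Ax u2 \* Dy v1) \+ dy (Ay v1 \* Ax u2)),
   2^-1 *: resY (ax (Ay u1 \* Dx v2) \+ dx (Ay u1 \* Ax v2)
                 \+ u2 \* Dy (ay v2) \+ Ay (dy (u2 \* v2)))).

Definition ipC (r s : cellf) : R :=
  hx * hy * \sum_i \sum_j r i j * s i j.
Definition ipX (r s : xfacef) : R :=
  hx * hy * \sum_i \sum_j r i j * s i j.
Definition ipY (r s : yfacef) : R :=
  hx * hy * \sum_i \sum_j r i j * s i j.

(* Trapezoidal weight in one direction; the product of the two is 1 at
   interior vertices, 1/2 on edges and 1/4 at corners. *)
Definition wgt1 (n i : nat) : R := if (i == 0%N) || (i == n) then 2^-1 else 1.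

Definition ipV (r s : vertf) : R :=
  hx * hy *
    \sum_(i < Nx.+1) \sum_(j < Ny.+1) (wgt1 Nx i * wgt1 Ny j) * r i j * s i j.

Definition ipE (u v : velf) : R := ipX u.1 v.1 + ipY u.2 v.2.

Definition normC (r : cellf) : R := Num.sqrt (ipC r r).
Definition normV (r : vertf) : R := Num.sqrt (ipV r r).
Definition normE (u : velf) : R := Num.sqrt (ipE u u).

(* The squared norm ||D_h v||_h^2 of the gradient of a velocity. *)
Definition grad_sqnormE (v : velf) : R :=
  normC (resC (dx (extX v.1))) ^+ 2 + normV (resV (Dy (extX v.1))) ^+ 2 +
  normV (resV (Dx (extY v.2))) ^+ 2 + normC (resC (dy (extY v.2))) ^+ 2.

Definition Gh (a b : velf) : R :=
  4^-1 * (normE a ^+ 2 + normE (2 *: a - b) ^+ 2).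

Definition Fpot (s : R) : R := 4^-1 * (s ^+ 2 - 1) ^+ 2.
Definition chi (a b : R) : R := 4^-1 * (a ^+ 2 + b ^+ 2) * (a + b).

End Space.

(* Each of these is indexed by the latest time level involved: the value at n
   uses q n, q n.-1 and q n.-2, and is meaningful for n >= 2 (n >= 1 for
   dagger). *)
Section Time.
Context {R : realType} {V : lmodType R}.

Definition D2tau (tau : R) (q : nat -> V) (n : nat) : V :=
  (2 * tau)^-1 *: (3 *: q n - 4 *: q n.-1 + q n.-2).
Definition delta2 (q : nat -> V) (n : nat) : V :=
  q n - 2 *: q n.-1 + q n.-2.
Definition qstar (q : nat -> V) (n : nat) : V := 2 *: q n.-1 - q n.-2.
Definition dagger (q : nat -> V) (n : nat) : V := 2^-1 *: (3 *: q n - q n.-1).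

End Time.

Definition energy {R : realType} (g : grid R) (eps : R)
    (phi : nat -> cellf g) (u : nat -> velf g) (j : nat) : R :=
  Gh (u j) (u j.-1) + eps ^+ 2 * Gh (gradh (phi j)) (gradh (phi j.-1)) +
  ipC (map_mx (@Fpot R) (dagger phi j)) (const_mx 1) +
  3 / 8 * normC (phi j - phi j.-1) ^+ 2.

(* Main.v *)
(* Test the momentum equation with tau u^{n+1}, the phase equation with
   tau mu^{n+1} and the potential equation with (3 phi^{n+1} - 4 phi^n +
   phi^{n-1}) / 2, which is the difference of the two consecutive dagger
   values.  Summation by parts makes the pressure term and the two coupling terms
   cancel, and turns the convection term into telescoping sums with vanishing
   boundary terms.  The factor chi(a, b)(a - b) = (a^4 - b^4) / 4 gives the
   quartic part of the potential; the quadratic part left over is an exact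
   difference plus (3/4) |delta^2 phi|^2. *)
Require Import Defs.
From mathcomp Require Import all_boot all_order all_algebra.
From mathcomp Require Import reals ring lra.

Set Implicit Arguments.
Unset Strict Implicit.
Unset Printing Implicit Defensive.

Import Order.TTheory GRing.Theory Num.Theory.

Local Open Scope ring_scope.

(** * One-dimensional telescoping: summation by parts and skew-symmetry along a grid line *)

Section OneDim.
Variable R : realType.
Implicit Types (n : nat) (f u v w : int -> R) (h : R).

Lemma intSr k : k.+1%:Z = k%:Z + 1.
Proof. by rewrite -addn1. Qed.

Lemma telescope_int n f : \sum_(k < n) (f (k%:Z + 1) - f k%:Z) = f n%:Z - f 0.
Proof.
elim: n => [|n IHn]; first by rewrite big_ord0 subrr.
by rewrite big_ord_recr /= IHn intSr addrC addrA subrK.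
Qed.

(** With the last cell split off using [v n = 0], the remaining terms combine into differences of
    [f k * v k / h]. The telescoped value at the far end cancels the split-off term, and [v 0 = 0]
    removes the other end. *)
Lemma summation_by_parts n f v h : (0 < n)%N -> v 0 = 0 -> v n%:Z = 0 ->
  \sum_(k < n.-1) (f k.+1%:Z - f (k.+1%:Z - 1)) / h * v k.+1%:Z =
  - \sum_(k < n) f k%:Z * ((v (k%:Z + 1) - v k%:Z) / h).
Proof.
case: n => // n _ v0 vn; apply/eqP; rewrite -addr_eq0; apply/eqP.
rewrite big_ord_recr /= -intSr vn sub0r addrA -big_split /=.
rewrite (eq_bigr (fun k : 'I_n => f (k%:Z + 1) * v (k%:Z + 1) / h
                              - f k%:Z * v k%:Z / h)); last first.
  by move=> k _; rewrite intSr addrK; ring.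
by rewrite (telescope_int n (fun k => f k * v k / h)) v0; ring.
Qed.

(** The discrete product rule gives a telescoping sum of [D k * u k / h] minus the full squares of
    [D] at 1 to [n]. Odd ghost values make [u / h] equal to [D / 2] at both ends, so the boundary
    terms are half squares: one is added at 0, the other cancels half of the square at [n]. This is
    the origin of the trapezoidal weights. *)
Lemma summation_by_parts_odd n u h : (0 < n)%N ->
    u (- 1) = - u 0 -> u n%:Z = - u (n%:Z - 1) ->
  let D k := (u k - u (k - 1)) / h in
  \sum_(k < n) (D (k%:Z + 1) - D k%:Z) / h * u k%:Z =
  - \sum_(k < n.+1) @wgt1 R n k * (D k%:Z * D k%:Z).
Proof.
case: n => // n _ u0 un D.
rewrite [in RHS]big_ord_recl [in RHS]big_ord_recr /= /wgt1 /= eqxx.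
rewrite [in RHS](eq_bigr (fun k : 'I_n => D (k%:Z + 1) * D (k%:Z + 1))); last first.
  move=> k _; rewrite /bump /= add1n eqSS.
  by rewrite (ltn_eqF (ltn_ord k)) mul1r intSr.
have -> : \sum_(k < n.+1) (D (k%:Z + 1) - D k%:Z) / h * u k%:Z =
    \sum_(k < n.+1) (D (k%:Z + 1) * u (k%:Z + 1) / h - D k%:Z * u k%:Z / h)
      - \sum_(k < n.+1) (D (k%:Z + 1) * D (k%:Z + 1)).
  rewrite -sumrB; apply: eq_bigr => k _.
  have e : D (k%:Z + 1) = (u (k%:Z + 1) - u k%:Z) / h by rewrite /D addrK.
  by rewrite e; ring.
rewrite (telescope_int n.+1 (fun k => D k * u k / h)) big_ord_recr /= -intSr.
have D0 : u 0 / h = D 0 / 2 by rewrite /D sub0r u0 opprK; lra.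
have Dn : u n.+1%:Z / h = D n.+1%:Z / 2.
  by rewrite /D -[u (n.+1%:Z - 1)]opprK -un; lra.
rewrite -!mulrA D0 Dn; lra.
Qed.

(** The weights differ from 1 only at the two ends, where [f] vanishes. This passes from vertices to
    interior faces in the direction normal to a wall. *)
Lemma sum_wgt1 n f : (0 < n)%N -> f 0 = 0 -> f n%:Z = 0 ->
  \sum_(k < n.+1) @wgt1 R n k * f k%:Z = \sum_(k < n.-1) f k.+1%:Z.
Proof.
case: n => // n _ f0 fn;
rewrite big_ord_recl big_ord_recr /= f0 fn !mulr0 add0r addr0.
apply: eq_bigr => k _; rewrite /wgt1 /bump /= add1n eqSS.
by rewrite (ltn_eqF (ltn_ord k)) mul1r.
Qed.

(** Transport of a component along its own direction. Advective and conservative parts together give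
    differences of the flux [P] below, which contains two consecutive values of [v] and so vanishes
    at both ends. *)
Lemma convection_face_skew n u v h : (0 < n)%N -> v 0 = 0 -> v n%:Z = 0 ->
  \sum_(k < n.-1)
    (u k.+1%:Z * (((v (k.+1%:Z + 1) + v k.+1%:Z) / 2
         - (v (k.+1%:Z - 1 + 1) + v (k.+1%:Z - 1)) / 2) / h)
     + ((u (k.+1%:Z + 1) * v (k.+1%:Z + 1) - u k.+1%:Z * v k.+1%:Z) / h
        + (u (k.+1%:Z - 1 + 1) * v (k.+1%:Z - 1 + 1)
           - u (k.+1%:Z - 1) * v (k.+1%:Z - 1)) / h) / 2) * v k.+1%:Z = 0.
Proof.
case: n => // n _ v0 vn.
pose P k := (u k + u (k + 1)) * v k * v (k + 1) / h / 2.
rewrite (eq_bigr (fun k : 'I_n => P (k%:Z + 1) - P k%:Z)); last first.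
  by move=> k _; rewrite /P intSr !addrK; lra.
by rewrite telescope_int /P v0 -intSr vn; ring.
Qed.

(** Transport of a component across its own direction, with [w] the transporting velocity averaged
    to vertices. The squares of [v k] cancel between the two parts, leaving differences of [P],
    which vanishes with [w] on the walls. *)
Lemma convection_cell_skew n w v h : w 0 = 0 -> w n%:Z = 0 ->
  \sum_(k < n)
    ((w (k%:Z + 1) * ((v (k%:Z + 1) - v (k%:Z + 1 - 1)) / h)
      + w k%:Z * ((v k%:Z - v (k%:Z - 1)) / h)) / 2
     + ((v (k%:Z + 1) + v (k%:Z + 1 - 1)) / 2 * w (k%:Z + 1)
        - (v k%:Z + v (k%:Z - 1)) / 2 * w k%:Z) / h) * v k%:Z = 0.
Proof.
move=> w0 wn; pose P k := w k * v k * v (k - 1) / h.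
rewrite (eq_bigr (fun k : 'I_n => P (k%:Z + 1) - P k%:Z)); last first.
  by move=> k _; rewrite /P !addrK; lra.
by rewrite telescope_int /P w0 wn; ring.
Qed.
End OneDim.

(** * Grid spacings, and the boundary and ghost values of extended fields *)

Section Grid.
Variables (R : realType) (g : grid R).
Local Notation Nx := (Nx g).
Local Notation Ny := (Ny g).
Implicit Types (f : @field R) (r s : cellf g) (v w : velf g).

Lemma hx_gt0 : 0 < hx g.
Proof. by rewrite divr_gt0 ?Lx_gt0// ltr0n Nx_gt0. Qed.

Lemma hy_gt0 : 0 < hy g.
Proof. by rewrite divr_gt0 ?Ly_gt0// ltr0n Ny_gt0. Qed.

Lemma entry_ord m n (A : 'M[R]_(m, n)) (i : 'I_m) (j : 'I_n) :
  entry A i%:Z j%:Z = A i j.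
Proof. by rewrite /entry !valK. Qed.

(** Index [m - 1] is one past the last row, so the default value 0 is read. Since [extX] shifts its
    index by one, this is the no-slip value on the right wall. *)
Lemma entry_lastl m n (A : 'M[R]_(m.-1, n)) k :
  (0 < m)%N -> entry A (m%:Z - 1) k = 0.
Proof.
by case: m A => // m A _; rewrite intSr addrK /entry insubN ?ltnn//; case: k.
Qed.

Lemma entry_lastr m n (A : 'M[R]_(m, n.-1)) k :
  (0 < n)%N -> entry A k (n%:Z - 1) = 0.
Proof.
case: n A => // n A _; rewrite intSr addrK /entry.
by case: k => // k; rewrite [insub n]insubN ?ltnn//; case: insub.
Qed.

Lemma reflect_idx_ord n (k : 'I_n) : reflect_idx n k%:Z = k%:Z.
Proof. by rewrite /reflect_idx /= eqz_nat (ltn_eqF (ltn_ord k)). Qed.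

Lemma reflect_sgn_ord n (k : 'I_n) : reflect_sgn n k%:Z = 1 :> R.
Proof. by rewrite /reflect_sgn /= eqz_nat (ltn_eqF (ltn_ord k)). Qed.

Lemma extC_ord (r : cellf g) (i : 'I_Nx) (j : 'I_Ny) : extC r (i%:Z, j%:Z) = r i j.
Proof. by rewrite /extC /= !reflect_idx_ord entry_ord. Qed.

Lemma extX_ord (v : xfacef g) (i : 'I_Nx.-1) (j : 'I_Ny) :
  extX v (i.+1%:Z, j%:Z) = v i j.
Proof.
by rewrite /extX [fst _]/= [snd _]/= reflect_idx_ord reflect_sgn_ord
   mul1r intSr addrK entry_ord.
Qed.

Lemma extY_ord (v : yfacef g) (i : 'I_Nx) (j : 'I_Ny.-1) :
  extY v (i%:Z, j.+1%:Z) = v i j.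
Proof.
by rewrite /extY [fst _]/= [snd _]/= reflect_idx_ord reflect_sgn_ord
   mul1r intSr addrK entry_ord.
Qed.

Lemma extX_left (v : xfacef g) k : extX v (0, k) = 0.
Proof. by rewrite /extX /= mulr0. Qed.

Lemma extX_right (v : xfacef g) k : extX v (Nx%:Z, k) = 0.
Proof. by rewrite /extX [fst _]/= [snd _]/= entry_lastl ?mulr0// Nx_gt0. Qed.

Lemma extY_bottom (v : yfacef g) k : extY v (k, 0) = 0.
Proof. by rewrite /extY /= /entry; case: reflect_idx => *; rewrite mulr0. Qed.

Lemma extY_top (v : yfacef g) k : extY v (k, Ny%:Z) = 0.
Proof. by rewrite /extY [fst _]/= [snd _]/= entry_lastr ?mulr0// Ny_gt0. Qed.

Lemma reflect_idx_low n : (0 < n)%N -> reflect_idx n (- 1) = reflect_idx n 0.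
Proof. by case: n. Qed.

Lemma reflect_sgn_low n : (0 < n)%N -> reflect_sgn n (- 1) = - reflect_sgn n 0 :> R.
Proof. by case: n. Qed.

Lemma reflect_idx_high n :
  (0 < n)%N -> reflect_idx n n%:Z = reflect_idx n (n%:Z - 1).
Proof.
case: n => // n _; rewrite {1}/reflect_idx /= eqxx intSr addrK.
by rewrite (reflect_idx_ord (@ord_max n)).
Qed.

Lemma reflect_sgn_high n :
  (0 < n)%N -> reflect_sgn n n%:Z = - reflect_sgn n (n%:Z - 1) :> R.
Proof.
case: n => // n _; rewrite {1}/reflect_sgn /= eqxx intSr addrK.
by rewrite (reflect_sgn_ord (@ord_max n)).
Qed.

Lemma extX_bottom (v : xfacef g) k : extX v (k, - 1) = - extX v (k, 0).
Proof.
by rewrite /extX [fst _]/= [snd _]/= reflect_idx_low ?reflect_sgn_low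
   ?Ny_gt0// mulNr.
Qed.

Lemma extX_top (v : xfacef g) k : extX v (k, Ny%:Z) = - extX v (k, Ny%:Z - 1).
Proof.
by rewrite /extX [fst _]/= [snd _]/= reflect_idx_high ?reflect_sgn_high
   ?Ny_gt0// mulNr.
Qed.

Lemma extY_left (v : yfacef g) k : extY v (- 1, k) = - extY v (0, k).
Proof.
by rewrite /extY [fst _]/= [snd _]/= reflect_idx_low ?reflect_sgn_low
   ?Nx_gt0// mulNr.
Qed.

Lemma extY_right (v : yfacef g) k : extY v (Nx%:Z, k) = - extY v (Nx%:Z - 1, k).
Proof.
by rewrite /extY [fst _]/= [snd _]/= reflect_idx_high ?reflect_sgn_high
   ?Nx_gt0// mulNr.
Qed.

(** * Inner products as sums over extended fields, and duality of gradient and divergence *)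

Lemma ipX_res f (v : xfacef g) :
  ipX (resX g f) v = hx g * hy g * \sum_(i < Nx.-1) \sum_(j < Ny)
     f (i.+1%:Z, j%:Z) * extX v (i.+1%:Z, j%:Z).
Proof.
congr (_ * _); apply: eq_bigr => i _; apply: eq_bigr => j _.
by rewrite mxE extX_ord.
Qed.

Lemma ipY_res f (v : yfacef g) :
  ipY (resY g f) v = hx g * hy g * \sum_(i < Nx) \sum_(j < Ny.-1)
     f (i%:Z, j.+1%:Z) * extY v (i%:Z, j.+1%:Z).
Proof.
congr (_ * _); apply: eq_bigr => i _; apply: eq_bigr => j _.
by rewrite mxE extY_ord.
Qed.

Lemma ipC_res r f :
  ipC r (resC g f) = hx g * hy g * \sum_(i < Nx) \sum_(j < Ny)
     extC r (i%:Z, j%:Z) * f (i%:Z, j%:Z).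
Proof.
congr (_ * _); apply: eq_bigr => i _; apply: eq_bigr => j _.
by rewrite mxE extC_ord.
Qed.

Lemma summation_by_parts_x f (v : xfacef g) :
  \sum_(i < Nx.-1) \sum_(j < Ny)
     Dx g f (i.+1%:Z, j%:Z) * extX v (i.+1%:Z, j%:Z) =
  - \sum_(i < Nx) \sum_(j < Ny) f (i%:Z, j%:Z) * dx g (extX v) (i%:Z, j%:Z).
Proof.
rewrite exchange_big [in RHS]exchange_big -sumrN; apply: eq_bigr => j _ /=.
apply: (@summation_by_parts _ _ (fun k => f (k, j%:Z))
         (fun k => extX v (k, j%:Z))).
- exact: Nx_gt0.
- exact: extX_left.
- exact: extX_right.
Qed.

Lemma summation_by_parts_y f (v : yfacef g) :
  \sum_(i < Nx) \sum_(j < Ny.-1)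
     Dy g f (i%:Z, j.+1%:Z) * extY v (i%:Z, j.+1%:Z) =
  - \sum_(i < Nx) \sum_(j < Ny) f (i%:Z, j%:Z) * dy g (extY v) (i%:Z, j%:Z).
Proof.
rewrite -sumrN; apply: eq_bigr => i _.
apply: (@summation_by_parts _ _ (fun k => f (i%:Z, k))
         (fun k => extY v (i%:Z, k))).
- exact: Ny_gt0.
- exact: extY_bottom.
- exact: extY_top.
Qed.

(** Velocities vanish on the normal walls, so summation by parts in each direction leaves no
    boundary term. This one duality serves the pressure, the diffusion of [mu] and [phi], and the
    phase flux. *)
Lemma gradh_divh r v : ipE (gradh r) v = - ipC r (divh v).
Proof.
rewrite /ipE ipX_res ipY_res summation_by_parts_x summation_by_parts_y ipC_res.
rewrite -mulrDr -mulrN -opprD -big_split; congr (_ * - _).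
apply: eq_bigr => i _; rewrite -big_split; apply: eq_bigr => j _ /=.
by rewrite mulrDr.
Qed.

(** * Bilinearity, symmetry and positivity of the inner products *)

Lemma sum_mulmxDl m n (A B C : 'M[R]_(m, n)) :
  \sum_i \sum_j (A + B) i j * C i j =
  \sum_i \sum_j A i j * C i j + \sum_i \sum_j B i j * C i j.
Proof.
rewrite -big_split; apply: eq_bigr => i _; rewrite -big_split.
by apply: eq_bigr => j _; rewrite mxE mulrDl.
Qed.

Lemma sum_mulmxZl m n a (A C : 'M[R]_(m, n)) :
  \sum_i \sum_j (a *: A) i j * C i j = a * \sum_i \sum_j A i j * C i j.
Proof.
rewrite mulr_sumr; apply: eq_bigr => i _; rewrite mulr_sumr.
by apply: eq_bigr => j _; rewrite mxE mulrA.
Qed.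

Lemma ipEC v w : ipE v w = ipE w v.
Proof.
rewrite /ipE /ipX /ipY.
by congr (_ * _ + _ * _); do 2?[apply: eq_bigr => ? _]; rewrite mulrC.
Qed.

Lemma ipEDl v1 v2 w : ipE (v1 + v2) w = ipE v1 w + ipE v2 w.
Proof. by rewrite /ipE /ipX /ipY !sum_mulmxDl; ring. Qed.

Lemma ipEZl a v w : ipE (a *: v) w = a * ipE v w.
Proof. by rewrite /ipE /ipX /ipY !sum_mulmxZl; ring. Qed.

Lemma ipENl v w : ipE (- v) w = - ipE v w.
Proof. by rewrite -scaleN1r ipEZl mulN1r. Qed.

Lemma ipEDr v w1 w2 : ipE v (w1 + w2) = ipE v w1 + ipE v w2.
Proof. by rewrite ipEC ipEDl !(ipEC v). Qed.

Lemma ipEZr a v w : ipE v (a *: w) = a * ipE v w.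
Proof. by rewrite ipEC ipEZl ipEC. Qed.

Lemma ipENr v w : ipE v (- w) = - ipE v w.
Proof. by rewrite ipEC ipENl ipEC. Qed.

Lemma ipE0l w : ipE 0 w = 0.
Proof. by rewrite -(scale0r 0) ipEZl mul0r. Qed.

Lemma ipCC r s : ipC r s = ipC s r.
Proof.
rewrite /ipC.
by congr (_ * _); do 2?[apply: eq_bigr => ? _]; rewrite mulrC.
Qed.

Lemma ipCDl r1 r2 s : ipC (r1 + r2) s = ipC r1 s + ipC r2 s.
Proof. by rewrite /ipC !sum_mulmxDl; ring. Qed.

Lemma ipCZl a r s : ipC (a *: r) s = a * ipC r s.
Proof. by rewrite /ipC !sum_mulmxZl; ring. Qed.

Lemma ipCNl r s : ipC (- r) s = - ipC r s.
Proof. by rewrite -scaleN1r ipCZl mulN1r. Qed.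

Lemma ipC0l s : ipC 0 s = 0.
Proof. by rewrite -(scale0r 0) ipCZl mul0r. Qed.

Lemma sum_mulmx_ge0 m n (A : 'M[R]_(m, n)) : 0 <= \sum_i \sum_j A i j * A i j.
Proof. by do 2?[apply: sumr_ge0 => ? _]; rewrite -expr2 sqr_ge0. Qed.

Lemma hxy_ge0 : 0 <= hx g * hy g.
Proof. by rewrite ltW// mulr_gt0 ?hx_gt0 ?hy_gt0. Qed.

Lemma ipE_ge0 v : 0 <= ipE v v.
Proof. by apply: addr_ge0; exact: mulr_ge0 hxy_ge0 (sum_mulmx_ge0 _). Qed.

Lemma ipC_ge0 r : 0 <= ipC r r.
Proof. exact: mulr_ge0 hxy_ge0 (sum_mulmx_ge0 _). Qed.

Lemma ipV_ge0 (z : vertf g) : 0 <= ipV z z.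
Proof.
have wge0 n k : 0 <= wgt1 n k :> R.
  by rewrite /wgt1; case: ifP => _; rewrite ?invr_ge0.
apply: mulr_ge0 hxy_ge0 _; do 2?[apply: sumr_ge0 => ? _].
by rewrite -mulrA -expr2 mulr_ge0 ?sqr_ge0 ?mulr_ge0.
Qed.

Lemma sqr_normE v : normE v ^+ 2 = ipE v v.
Proof. by rewrite sqr_sqrtr ?ipE_ge0. Qed.

Lemma sqr_normC r : normC r ^+ 2 = ipC r r.
Proof. by rewrite sqr_sqrtr ?ipC_ge0. Qed.

Lemma sqr_normV (z : vertf g) : normV z ^+ 2 = ipV z z.
Proof. by rewrite sqr_sqrtr ?ipV_ge0. Qed.

(** * Energy properties of convection and viscosity *)

Lemma convh_skew v w : ipE (convh v w) w = 0.
Proof.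
(* The factor 1/2 shared by both components is pulled out, so that each component is a plain sum of
   four terms. *)
have -> : convh v w = 2^-1 *: (2 *: convh v w).
  by rewrite scalerA mulVf ?scale1r// pnatr_eq0.
rewrite ipEZl {1}/convh; set c1 := resX g _; set c2 := resY g _.
have -> : 2 *: (2^-1 *: c1, 2^-1 *: c2) = (c1, c2) :> velf g.
  by congr pair; rewrite /= scalerA mulfV ?scale1r// pnatr_eq0.
rewrite /ipE /= /c1 /c2 ipX_res ipY_res.
set Sx := \sum_(i < _) _; set Sy := \sum_(i < _) _.
suff [-> ->] : Sx = 0 /\ Sy = 0 by rewrite mulr0 addr0 mulr0.
split.
- rewrite /Sx.
  (* The four terms are grouped in pairs: the first pair differentiates in x and vanishes on each
     horizontal grid line, the second in y and vanishes on each vertical one. *)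
  under eq_bigr do (under eq_bigr do rewrite /= -addrA mulrDl).
  under eq_bigr do rewrite big_split /=.
  rewrite big_split /= exchange_big /= [X in X + _]big1 ?add0r; last first.
    move=> j _; apply: (@convection_face_skew _ _
      (fun k => extX v.1 (k, j%:Z))
      (fun k => extX w.1 (k, j%:Z))).
    + exact: Nx_gt0.
    + exact: extX_left.
    + exact: extX_right.
  apply: big1 => i _.
  apply: (@convection_cell_skew _ _
      (fun k => Ax (extY v.2) (i.+1%:Z, k))
      (fun k => extX w.1 (i.+1%:Z, k))).
  + by rewrite /Ax !extY_bottom addr0 mul0r.
  + by rewrite /Ax !extY_top addr0 mul0r.
- rewrite /Sy.
  under eq_bigr do (under eq_bigr do rewrite /= -addrA mulrDl).
  under eq_bigr do rewrite big_split /=.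
  rewrite big_split /= [X in _ + X]big1 ?addr0; last first.
    move=> i _; apply: (@convection_face_skew _ _
      (fun k => extY v.2 (i%:Z, k))
      (fun k => extY w.2 (i%:Z, k))).
    + exact: Ny_gt0.
    + exact: extY_bottom.
    + exact: extY_top.
  rewrite exchange_big; apply: big1 => j _ /=.
  (* In the second component the flux lists the transporting velocity first; swapping the factors
     restores the order of the one-dimensional identity. *)
  have dxC f1 f2 k : dx g (f1 \* f2) k = dx g (f2 \* f1) k.
    by rewrite /dx /= ![f1 _ * _]mulrC.
  under eq_bigr do rewrite (dxC (Ay _)).
  apply: (@convection_cell_skew _ _
      (fun k => Ay (extX v.1) (k, j.+1%:Z))
      (fun k => extY w.2 (k, j.+1%:Z))).
  + by rewrite /Ay !extX_left addr0 mul0r.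
  + by rewrite /Ay !extX_right addr0 mul0r.
Qed.

(** The two directions play different roles. In y, the difference vanishes on the horizontal walls,
    so the weighted vertex sum reduces to interior rows; in x, the odd ghost values produce the
    weights. *)
Lemma summation_by_parts_odd_x (v : yfacef g) :
  \sum_(i < Nx) \sum_(j < Ny.-1)
     dx g (Dx g (extY v)) (i%:Z, j.+1%:Z) * extY v (i%:Z, j.+1%:Z) =
  - \sum_(i < Nx.+1) \sum_(j < Ny.+1) (wgt1 Nx i * wgt1 Ny j)
     * resV g (Dx g (extY v)) i j * resV g (Dx g (extY v)) i j.
Proof.
pose D2 k l := Dx g (extY v) (k, l) * Dx g (extY v) (k, l).
rewrite [in RHS](eq_bigr (fun i : 'I_Nx.+1 =>
    \sum_(j < Ny.-1) wgt1 Nx i * D2 i%:Z j.+1%:Z)); last first.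
  move=> i _; rewrite -mulr_sumr -(@sum_wgt1 _ _ (D2 i%:Z)).
  - rewrite mulr_sumr; apply: eq_bigr => j _.
    by rewrite !mxE [RHS]mulrA [RHS]mulrA.
  - exact: Ny_gt0.
  - by rewrite /D2 /Dx !extY_bottom subrr mul0r mulr0.
  - by rewrite /D2 /Dx !extY_top subrr mul0r mulr0.
rewrite exchange_big [in RHS]exchange_big -sumrN; apply: eq_bigr => j _ /=.
apply: (@summation_by_parts_odd _ _ (fun k => extY v (k, j.+1%:Z))).
- exact: Nx_gt0.
- exact: extY_left.
- exact: extY_right.
Qed.

Lemma summation_by_parts_odd_y (v : xfacef g) :
  \sum_(i < Nx.-1) \sum_(j < Ny)
     dy g (Dy g (extX v)) (i.+1%:Z, j%:Z) * extX v (i.+1%:Z, j%:Z) =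
  - \sum_(i < Nx.+1) \sum_(j < Ny.+1) (wgt1 Nx i * wgt1 Ny j)
     * resV g (Dy g (extX v)) i j * resV g (Dy g (extX v)) i j.
Proof.
pose D2 l k := Dy g (extX v) (k, l) * Dy g (extX v) (k, l).
rewrite [in RHS]exchange_big /=.
rewrite [in RHS](eq_bigr (fun j : 'I_Ny.+1 =>
    \sum_(i < Nx.-1) wgt1 Ny j * D2 j%:Z i.+1%:Z)); last first.
  move=> j _; rewrite -mulr_sumr -(@sum_wgt1 _ _ (D2 j%:Z)).
  - rewrite mulr_sumr; apply: eq_bigr => i _.
    by rewrite !mxE [RHS]mulrCA [RHS]mulrA [RHS]mulrA.
  - exact: Nx_gt0.
  - by rewrite /D2 /Dy !extX_left subrr mul0r mulr0.
  - by rewrite /D2 /Dy !extX_right subrr mul0r mulr0.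
rewrite [in RHS]exchange_big -sumrN; apply: eq_bigr => i _ /=.
apply: (@summation_by_parts_odd _ _ (fun k => extX v (i.+1%:Z, k))).
- exact: Ny_gt0.
- exact: extX_bottom.
- exact: extX_top.
Qed.

(** Each component has a second difference normal to the walls where it is prescribed, handled by
    its zero values there, and a tangential one, handled by odd reflection. They yield the cell
    norms and the vertex norms respectively. *)
Lemma AhE_coercive v : ipE (AhE v) v = grad_sqnormE v.
Proof.
rewrite /grad_sqnormE !sqr_normC !sqr_normV.
have -> : AhE v = - (resX g (Dx g (dx g (extX v.1)) \+ dy g (Dy g (extX v.1))),
                     resY g (dx g (Dx g (extY v.2)) \+ Dy g (dy g (extY v.2)))).
  by [].
rewrite ipENl /ipE /= ipX_res ipY_res.
have sumD m n (F1 F2 F3 : 'I_m -> 'I_n -> R) :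
    \sum_i \sum_j (F1 i j + F2 i j) * F3 i j =
    \sum_i \sum_j F1 i j * F3 i j + \sum_i \sum_j F2 i j * F3 i j.
  rewrite -big_split; apply: eq_bigr => i _; rewrite -big_split.
  by apply: eq_bigr => j _; rewrite mulrDl.
rewrite !sumD summation_by_parts_x summation_by_parts_y.
rewrite summation_by_parts_odd_x summation_by_parts_odd_y.
rewrite /ipV /ipC.
have sumres m n (f : @field R) :
    \sum_(i < m) \sum_(j < n) f (i%:Z, j%:Z) * f (i%:Z, j%:Z) =
    \sum_i \sum_j (\matrix_(i < m, j < n) f (i%:Z, j%:Z)) i j
                   * (\matrix_(i < m, j < n) f (i%:Z, j%:Z)) i j.
  by apply: eq_bigr => i _; apply: eq_bigr => j _; rewrite mxE.
by rewrite !sumres; ring.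
Qed.

(** * Linearity of the gradient, symmetry of the coupling, and time-stepping identities *)

Lemma gradhD r s : gradh (r + s) = gradh r + gradh s.
Proof.
have entryD m n (A B : 'M[R]_(m, n)) k l :
    entry (A + B) k l = entry A k l + entry B k l.
  rewrite /entry; case: k => k; case: l => l; rewrite ?addr0//.
  by case: (insub k : option 'I_m) => [i|];
    case: (insub l : option 'I_n) => [j|]; rewrite ?addr0 ?mxE.
have extD k : extC (r + s) k = extC r k + extC s k by exact: entryD.
by congr pair; apply/matrixP => i j; rewrite !mxE /Dx /Dy !extD; ring.
Qed.

Lemma gradhZ a r : gradh (a *: r) = a *: gradh r.
Proof.
have entryZ m n (A : 'M[R]_(m, n)) k l : entry (a *: A) k l = a * entry A k l.
  rewrite /entry; case: k => k; case: l => l; rewrite ?mulr0//.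
  by case: (insub k : option 'I_m) => [i|];
    case: (insub l : option 'I_n) => [j|]; rewrite ?mulr0 ?mxE.
have extZ k : extC (a *: r) k = a * extC r k by exact: entryZ.
by congr pair; apply/matrixP => i j; rewrite !mxE /Dx /Dy !extZ; ring.
Qed.

Lemma gradhN r : gradh (- r) = - gradh r.
Proof. by rewrite -scaleN1r gradhZ scaleN1r. Qed.

Lemma AhC_gradh r s : ipC (AhC r) s = ipE (gradh r) (gradh s).
Proof. by rewrite ipCNl ipCC ipEC gradh_divh. Qed.

(** Multiplication by the face averages of [r] is diagonal, hence self-adjoint. It identifies the
    work of the force [r] times a gradient with the pairing of that gradient against the phase
    flux. *)
Lemma prodh_sym r v w : ipE (prodh r v) w = ipE v (prodh r w).
Proof.
congr (_ + _); congr (_ * _); apply: eq_bigr => i _; apply: eq_bigr => j _.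
  by rewrite !mxE /= !extX_ord mulrCA mulrA.
by rewrite !mxE /= !extY_ord mulrCA mulrA.
Qed.

(** This is the G-stability identity of the second-order backward difference formula, with the
    newest level first. Once expanded by bilinearity, it is a polynomial identity in the pairings of
    the three levels. *)
Lemma Gh_bdf2 v1 v2 v3 :
  Gh v1 v2 - Gh v2 v3 + 4^-1 * normE (v1 - 2 *: v2 + v3) ^+ 2 =
  2^-1 * ipE (3 *: v1 - 4 *: v2 + v3) v1.
Proof.
rewrite /Gh !sqr_normE !(ipEDl, ipEDr, ipENl, ipENr, ipEZl, ipEZr).
by rewrite (ipEC v2 v1) (ipEC v3 v1) (ipEC v3 v2); field.
Qed.

(** The identity is pointwise, with [a - b] half of the tested combination. For the quadratic part,
    the mean $(a+b)/2$ exceeds the extrapolation $2r_2-r_3$ by $\frac34(d_1-d_2)$, where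
    $d_1=r_1-r_2$ and $d_2=r_2-r_3$. Multiplied by $a-b=(3d_1-d_2)/2$, this excess equals
    $\frac38(d_1^2-d_2^2)+\frac34(d_1-d_2)^2$. *)
Lemma potential_identity (r1 r2 r3 : cellf g) :
  let a := 2^-1 *: (3 *: r1 - r2) in let b := 2^-1 *: (3 *: r2 - r3) in
  2^-1 * ipC (map2_mx (@chi R) a b - (2 *: r2 - r3)) (3 *: r1 - 4 *: r2 + r3) =
  ipC (map_mx (@Fpot R) a) (const_mx 1) - ipC (map_mx (@Fpot R) b) (const_mx 1)
  + 3 / 8 * (normC (r1 - r2) ^+ 2 - normC (r2 - r3) ^+ 2)
  + 3 / 4 * normC (r1 - 2 *: r2 + r3) ^+ 2.
Proof.
move=> a b; rewrite !sqr_normC /ipC.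
(* The common cell area is factored out, which leaves an identity between plain sums that can be
   checked cell by cell. *)
suff sums : forall S0 S1 S2 S3 S4 S5 : R,
    2^-1 * S0 = S1 - S2 + 3 / 8 * (S3 - S4) + 3 / 4 * S5 ->
    2^-1 * (hx g * hy g * S0) = hx g * hy g * S1 - hx g * hy g * S2
      + 3 / 8 * (hx g * hy g * S3 - hx g * hy g * S4) + 3 / 4 * (hx g * hy g * S5).
  apply: sums; rewrite -!sumrB !mulr_sumr -!big_split; apply: eq_bigr => i _ /=.
  rewrite -!sumrB !mulr_sumr -!big_split; apply: eq_bigr => j _ /=.
  by rewrite !mxE /chi /Fpot; field.
move=> S0 S1 S2 S3 S4 S5 eqS.
by rewrite (mulrCA 2^-1) eqS; ring.
Qed.

End Grid.

(** * The energy law: testing the equations and assembling the balances *)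

Theorem theorem3p3 (R : realType) (g : grid R) (T : R) (N : nat)
    (eps nu : R)
    (phi mu p : nat -> cellf g) (u : nat -> velf g) :
  0 < T -> (2 <= N)%N -> 0 < eps -> 0 < nu ->
  let tau := T / N%:R in
  (forall n : nat, (1 <= n <= N - 1)%N ->
    [/\ D2tau tau u n.+1 + convh (qstar u n.+1) (u n.+1)
          + nu *: AhE (u n.+1) + gradh (p n.+1)
          + prodh (qstar phi n.+1) (gradh (mu n.+1)) = 0,
        divh (u n.+1) = 0,
        D2tau tau phi n.+1 + AhC (mu n.+1)
          + divh (prodh (qstar phi n.+1) (u n.+1)) = 0
      & mu n.+1 - eps ^+ 2 *: AhC (phi n.+1)
          - map2_mx (@chi R) (dagger phi n.+1) (dagger phi n)
          + qstar phi n.+1 = 0]) ->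
  forall n : nat, (1 <= n <= N - 1)%N ->
    energy eps phi u n.+1 - energy eps phi u n
      + tau * normE (gradh (mu n.+1)) ^+ 2
      + nu * tau * grad_sqnormE (u n.+1)
      + 4^-1 * normE (delta2 u n.+1) ^+ 2
      + eps ^+ 2 / 4 * normE (gradh (delta2 phi n.+1)) ^+ 2
      + 3 / 4 * normC (delta2 phi n.+1) ^+ 2 = 0
    /\ energy eps phi u n.+1 <= energy eps phi u n.
Proof.
move=> T0 N2 eps0 nu0 tau scheme n nN.
have tau0 : 0 < tau by rewrite divr_gt0// ltr0n (ltn_trans _ N2).
clearbody tau.
have [momentum divu0 phase potential] := scheme n nN.
(* The momentum equation is tested with the new velocity: convection drops by skew-symmetry, the
   pressure by incompressibility. The coupling term that remains reappears in [phaseE] with the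
   opposite sign. *)
have momentumE : (2 * tau)^-1 * ipE (3 *: u n.+1 - 4 *: u n + u n.-1) (u n.+1)
    + nu * grad_sqnormE (u n.+1)
    + ipE (gradh (mu n.+1)) (prodh (qstar phi n.+1) (u n.+1)) = 0.
  have := ipE0l (u n.+1).
  rewrite -{1}momentum 4!ipEDl 2!ipEZl convh_skew AhE_coercive.
  by rewrite [ipE (gradh (p _)) _]gradh_divh divu0 ipCC ipC0l oppr0 !addr0 prodh_sym.
(* This is twice the difference of consecutive [dagger] values; the factor 1/2 enters later, through
   [pot] and [grd]. *)
set dphi := 3 *: phi n.+1 - 4 *: phi n + phi n.-1.
have phaseE : (2 * tau)^-1 * ipC (mu n.+1) dphi
    + ipE (gradh (mu n.+1)) (gradh (mu n.+1))
    - ipE (gradh (mu n.+1)) (prodh (qstar phi n.+1) (u n.+1)) = 0.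
  have := ipC0l (mu n.+1); rewrite -{1}phase 2!ipCDl ipCZl AhC_gradh.
  rewrite [ipE _ (prodh _ _)]gradh_divh opprK [ipC (divh _) _]ipCC.
  by rewrite [ipC _ (mu n.+1)]ipCC.
have potentialE : ipC (mu n.+1) dphi
    - eps ^+ 2 * ipE (3 *: gradh (phi n.+1) - 4 *: gradh (phi n) + gradh (phi n.-1))
                     (gradh (phi n.+1))
    - ipC (map2_mx (@chi R) (dagger phi n.+1) (dagger phi n)
            - qstar phi n.+1) dphi = 0.
  have potential' : mu n.+1 - eps ^+ 2 *: AhC (phi n.+1)
      - (map2_mx (@chi R) (dagger phi n.+1) (dagger phi n) - qstar phi n.+1) = 0.
    by rewrite -potential opprB [qstar _ _ - _]addrC addrA.
  have := ipC0l dphi; rewrite -{1}potential'.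
  rewrite 2!ipCDl 2![ipC (- _) dphi]ipCNl ipCZl AhC_gradh [ipE _ (gradh dphi)]ipEC.
  by rewrite /dphi !(gradhD, gradhN, gradhZ).
have pot : 2^-1 * ipC (map2_mx (@chi R) (dagger phi n.+1) (dagger phi n)
                       - qstar phi n.+1) dphi =
    ipC (map_mx (@Fpot R) (dagger phi n.+1)) (const_mx 1)
    - ipC (map_mx (@Fpot R) (dagger phi n)) (const_mx 1)
    + 3 / 8 * (normC (phi n.+1 - phi n) ^+ 2 - normC (phi n - phi n.-1) ^+ 2)
    + 3 / 4 * normC (delta2 phi n.+1) ^+ 2.
  exact: potential_identity (phi n.+1) (phi n) (phi n.-1).
have kin : Gh (u n.+1) (u n) - Gh (u n) (u n.-1)
      + 4^-1 * normE (delta2 u n.+1) ^+ 2 =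
    2^-1 * ipE (3 *: u n.+1 - 4 *: u n + u n.-1) (u n.+1).
  exact: Gh_bdf2.
have grd := Gh_bdf2 (gradh (phi n.+1)) (gradh (phi n)) (gradh (phi n.-1)).
have dgrd : gradh (phi n.+1) - 2 *: gradh (phi n) + gradh (phi n.-1) =
    gradh (delta2 phi n.+1) by rewrite !(gradhD, gradhN, gradhZ).
rewrite dgrd in grd.
(* Multiplication by [tau] turns the factor $1/(2\tau)$ of the time difference into the 1/2 of [kin]
   and of the potential identities. *)
have halve a b : (2 * tau)^-1 * a + b = 0 -> 2^-1 * a + tau * b = 0.
  by move=> ab0; rewrite -[RHS](mulr0 tau) -ab0; field; rewrite gt_eqF.
rewrite -addrA in momentumE; rewrite -addrA in phaseE.
have identity : energy eps phi u n.+1 - energy eps phi u n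
      + tau * normE (gradh (mu n.+1)) ^+ 2
      + nu * tau * grad_sqnormE (u n.+1)
      + 4^-1 * normE (delta2 u n.+1) ^+ 2
      + eps ^+ 2 / 4 * normE (gradh (delta2 phi n.+1)) ^+ 2
      + 3 / 4 * normC (delta2 phi n.+1) ^+ 2 = 0.
  (* Multiplying by [eps ^+ 2] beforehand makes the final combination linear in the remaining
     products, as [lra] requires. *)
  have {}grd := congr1 ( *%R (eps ^+ 2)) grd.
  have := halve _ _ momentumE; have := halve _ _ phaseE; rewrite -kin.
  rewrite /energy /=; rewrite -[ipE (gradh (mu _)) (gradh _)]sqr_normE.
  move: pot potentialE grd; lra.
(* Energy decay follows once every dissipation term in the identity is seen to be nonnegative. *)
have Dmu_ge0 : 0 <= tau * normE (gradh (mu n.+1)) ^+ 2.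
  by rewrite mulr_ge0 ?sqr_ge0 ?ltW.
have Du_ge0 : 0 <= nu * tau * grad_sqnormE (u n.+1).
  apply: mulr_ge0; first by rewrite ltW// mulr_gt0.
  by rewrite !addr_ge0 ?sqr_ge0.
have ddu_ge0 := sqr_ge0 (normE (delta2 u n.+1)).
have ddphi_ge0 := sqr_ge0 (normC (delta2 phi n.+1)).
have Dddphi_ge0 : 0 <= eps ^+ 2 / 4 * normE (gradh (delta2 phi n.+1)) ^+ 2.
  by rewrite mulr_ge0 ?divr_ge0 ?sqr_ge0.
by split=> //; lra.
Qed.
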